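(* The number of non-isomorphic maximal Arrow's single-peaked domains $D$ on a set of size $m$ with $\sigma_D=\mathrm{id}$ is equal to $1$ for $m=3$, and to $\mathcal{P}(m-1)$ for all $m\geq 4$. All such domains are self-paired.
   Context: A linear order on a finite set $A$ of size $m$ is identified with a directed Hamilton path through $A$, i.e. a sequence $(a_1,\dots,a_m)$ listing every element of $A$ exactly once (most preferred first). A set $D$ of linear orders on $A$ is a Condorcet domain if there are no three orders in $D$ and distinct $a_1,a_2,a_3\in A$ such that the three orders rank these elements as $a_1\succ a_2\succ a_3$, $a_2\succ a_3\succ a_1$, $a_3\succ a_1\succ a_2$ respectively. It is maximal if it is not properly contained in another Condorcet domain on $A$. An Arrow's single-peaked domain is a Condorcet domain $D$ such that every triple (3-element subset) $T\subseteq A$ has a ''never-bottom'' element, i.e. an element of $T$ which no order of $D$ ranks last among the elements of $T$. A maximal Arrow's single-peaked domain is an Arrow's single-peaked domain which is maximal as a Condorcet domain. A terminal element of $D$ is an element which is last in some order of $D$; a maximal Arrow's single-peaked domain has exactly two terminal elements $s,f$. A path in $D$ is extremal if it starts at one terminal element and ends at the other; $D$ has exactly two extremal paths, $P=(s,a_1,\dots,a_{m-2},f)$ and $Q=(f,\sigma_D(a_1),\dots,\sigma_D(a_{m-2}),s)$, where $\sigma_D$ is a permutation of $A\setminus\{s,f\}$. The inherited permutation of $D$ is $\theta_D=(sf)\sigma_D$, the permutation of $A$ with $\theta_D(P)=Q$, where permutations act on paths entrywise. $D$ is self-paired if $\{\theta_D(W):W\in D\}=D$. Two domains are isomorphic if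 some bijection of the underlying sets carries one onto the other. $\mathcal{P}(n)$ denotes the total number of maximal Arrow's single-peaked domains on a set of size $n$ (counted as sets of orders, without reduction under isomorphism) which all share a common fixed extremal path. *)

(* Defs.v *)
From HB Require Import structures.
From mathcomp Require Import all_boot all_fingroup.

Set Implicit Arguments.
Unset Strict Implicit.
Unset Printing Implicit Defensive.

(* A uniq sequence of length #|A| over A lists every element of A exactly once
   (lemma mem_linorder below); the head is the most preferred element. *)
Record linorder (A : finType) : Type := LinOrder {
  path_of :> #|A|.-tuple A;
  _ : uniq path_of
}.

HB.instance Definition _ (A : finType) := [isSub for @path_of A].
HB.instance Definition _ (A : finType) := [Finite of linorder A by <:].

Section Domains.

Variable A : finType.

Implicit Types (D : {set linorder A}) (w P Q : linorder A).
Implicit Types (g sigma theta : {perm A}) (x y s f : A).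

Lemma linorder_uniq w : uniq w.
Proof. exact: valP w. Qed.

Lemma mem_linorder w x : x \in path_of w.
Proof.
have /subset_cardP : #|path_of w| = #|A| by rewrite (card_uniqP (linorder_uniq w)) size_tuple.
by move=> /(_ (subset_predT _)) ->.
Qed.

Definition prefers w x y : bool := index x w < index y w.

(* As w contains x, the default values of head and last are never used: these
   say that x is the first, resp. the last, element of w. *)
Definition first_in w x : bool := head x w == x.
Definition last_in w x : bool := last x w == x.

Definition condorcet D : bool :=
  ~~ [exists w1 in D, exists w2 in D, exists w3 in D,
      exists a1, exists a2, exists a3,
        [&& uniq [:: a1; a2; a3],
            prefers w1 a1 a2 && prefers w1 a2 a3,
            prefers w2 a2 a3 && prefers w2 a3 a1
          & prefers w3 a3 a1 && prefers w3 a1 a2]].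

Definition never_bottom D (T : {set A}) x : bool :=
  (x \in T) && [forall w in D, exists y in T, prefers w x y].

Definition arrow_single_peaked D : bool :=
  condorcet D &&
  [forall T : {set A}, (#|T| == 3) ==> [exists x, never_bottom D T x]].

Definition maximal_arrow_single_peaked D : bool :=
  arrow_single_peaked D && maxset condorcet D.

Definition terminal D x : bool := [exists w in D, last_in w x].

Definition extremal D w : bool :=
  (w \in D) &&
  [exists s, exists f, [&& terminal D s, terminal D f, s != f,
                           first_in w s & last_in w f]].

Lemma relabel_subproof g w : uniq (map_tuple g (path_of w)).
Proof. by rewrite map_inj_uniq ?linorder_uniq //; exact: perm_inj. Qed.

Definition relabel g w : linorder A := LinOrder (relabel_subproof g w).

Definition relabel_domain g D : {set linorder A} := relabel g @: D.

(* sigma, extended to A by fixing s and f, is the permutation sigma_D read with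
   s as the first element of P and f as the last one: if
   P = (s, a_1, ..., a_k, f), then relabel (tperm s f * sigma) P is the path
   Q = (f, sigma a_1, ..., sigma a_k, s). Exchanging the roles of P and Q
   exchanges s and f and replaces sigma by its inverse, so sigma_D is rendered
   as a relation. *)
Definition is_sigma D s f sigma : bool :=
  perm_on (~: [set s; f]) sigma &&
  [exists P, exists Q,
    [&& [set w | extremal D w] == [set P; Q],
        first_in P s, last_in P f
      & Q == relabel (tperm s f * sigma)%g P]].

Definition sigma_trivial D : bool := [exists s, exists f, is_sigma D s f 1%g].

Definition is_theta D theta : bool :=
  [exists s, exists f, exists sigma,
    is_sigma D s f sigma && (theta == (tperm s f * sigma)%g)].

(* By the remark on is_sigma, theta is determined up to inversion, and
   stability of D under theta does not depend on this choice. *)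
Definition self_paired D : bool :=
  [exists theta, is_theta D theta && (relabel_domain theta D == D)].

Definition isomorphic (D1 D2 : {set linorder A}) : bool :=
  [exists g : {perm A}, relabel_domain g D1 == D2].

(* The number of isomorphism classes of maximal Arrow's single-peaked domains
   on A whose permutation sigma_D is the identity. *)
Definition num_sigma_trivial : nat :=
  #|equivalence_partition isomorphic
      [set D | maximal_arrow_single_peaked D & sigma_trivial D]|.

(* The number written P(n) when #|A| = n; by relabelling it does not depend on
   the fixed path w. *)
Definition num_sharing_extremal w : nat :=
  #|[set D | maximal_arrow_single_peaked D & extremal D w]|.

End Domains.

Arguments num_sigma_trivial A : clear implicits.

(* Main.v *)
Require Import Defs.
From mathcomp Require Import all_boot all_fingroup.

(** Read every order from the bottom: at each stage an element is dropped from
    the set of those that remain. Being single-peaked means that no triple has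
    three bottoms, hence that at most two elements can be dropped from any set.
    A domain is a maximal Arrow's single-peaked domain if and only if it is
    nonempty and single-peaked, contains every order all of whose drops are
    possible in the domain ([drop_closed]), and offers a second choice whenever
    at least two elements remain ([full]). Necessity holds because otherwise an
    order could be added ([maximal_drop_closed], [maximal_full]). Conversely
    these conditions make the domain rich on triples
    ([drop_closed_full_copious]), so that any new order completes a Condorcet
    cycle ([drop_closed_full_maximal]). In terms of upper sets, such domains are
    the convex geometries in which every convex set with at least two points has
    exactly two extreme points.

    Let the permutation of such a domain be trivial, with extremal paths
    P = (s, a_1, ..., a_k, f) and Q = (f, a_1, ..., a_k, s). By Q the element s
    can be dropped from every set that contains it, so as long as s remains the
    other choice is the last element in P ([tail_forced]). It follows that
    the transposition (s f) maps the domain to itself ([mirrored_stable]), which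
    is self-pairedness. Moreover the domain is determined by its orders that end
    with f. With f removed they form a maximal Arrow's single-peaked domain on
    one element fewer, with extremal path (s, a_1, ..., a_k); conversely every
    such domain arises, by appending f and adding the images under (s f)
    ([doubling_maximal], [halving_maximal], [halvingK]).

    Up to relabelling, P can be fixed. An isomorphism between two domains with
    the same P then fixes or exchanges P and Q, so it is the identity or (s f),
    and the domains are equal ([mirrored_isomorphic]). So isomorphism classes
    correspond to the smaller domains with a fixed extremal path
    ([num_sigma_trivialE]). This holds for three elements as well, where the
    count of the smaller domains is 1 ([num_sharing_extremal_two]). *)

Set Implicit Arguments.
Unset Strict Implicit.
Unset Printing Implicit Defensive.

(** * Linear orders through their preference relations *)

Section Orders.

Variable A : finType.

Implicit Types (u v w : linorder A) (g : {perm A}) (x y z : A).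

Lemma prefers_irr w x : prefers w x x = false.
Proof. exact: ltnn. Qed.

Lemma prefers_neq w x y : prefers w x y -> x != y.
Proof. by apply: contraTneq => ->; rewrite prefers_irr. Qed.

Lemma prefers_trans w : transitive (prefers w).
Proof. by move=> y x z; apply: ltn_trans. Qed.

Lemma prefers_total w x y : x != y -> prefers w x y || prefers w y x.
Proof.
move=> neq_xy; rewrite /prefers -neq_ltn.
by apply: contraNneq neq_xy => /(index_inj x)->//; apply: mem_linorder.
Qed.

Lemma prefersN w x y : x != y -> ~~ prefers w x y = prefers w y x.
Proof.
move=> neq_xy; apply/idP/idP => [/negbTE nxy|yx].
  by have := prefers_total w neq_xy; rewrite nxy.
by rewrite /prefers -leqNgt ltnW.
Qed.

Lemma prefers_asym w x y : prefers w x y -> prefers w y x -> False.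
Proof. by move=> xy /(prefers_trans xy); rewrite prefers_irr. Qed.

Lemma prefersNN w x y z : ~~ prefers w x y -> prefers w x z -> prefers w y z.
Proof. by rewrite /prefers -leqNgt; apply: leq_ltn_trans. Qed.

Lemma linorder_inj u v :
  (forall x y, prefers u x y -> prefers v x y) -> u = v.
Proof.
move=> uv; do 2!apply: val_inj.
have sorted_self w : sorted (prefers w) w.
  case Ew: (path_of w : seq A) => [|a s] //; rewrite -Ew.
  apply/(sortedP a) => i ltiw.
  by rewrite /prefers !index_uniq ?linorder_uniq // ltnW.
apply: (@irr_sorted_eq _ (prefers v)) => //.
- exact: prefers_trans.
- exact: prefers_irr.
- by apply: sub_sorted (sorted_self u).
- by move=> x; rewrite !mem_linorder.
Qed.

Lemma prefers_relabel g w x y :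
  prefers (relabel g w) (g x) (g y) = prefers w x y.
Proof. by rewrite /prefers /= !index_map //; apply: perm_inj. Qed.

Lemma prefers_relabel_tperm a b w x y :
  prefers (relabel (tperm a b) w) x y = prefers w (tperm a b x) (tperm a b y).
Proof.
have := prefers_relabel (tperm a b) w (tperm a b x) (tperm a b y).
by rewrite !tpermK.
Qed.

Lemma relabelM g h w : relabel (g * h)%g w = relabel h (relabel g w).
Proof.
by do 2!apply: val_inj; rewrite /= -map_comp; apply: eq_map => x; rewrite permM.
Qed.

Lemma relabel1 w : relabel 1%g w = w.
Proof.
do 2!apply: val_inj; rewrite /= -[RHS]map_id.
by apply: eq_map => x; rewrite perm1.
Qed.

Lemma relabelK g : cancel (relabel g) (relabel g^-1%g).
Proof. by move=> w; rewrite -relabelM mulgV relabel1. Qed.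

Lemma relabel_transitive u v : exists g, relabel g u = v.
Proof.
have lt x : index x u < size v.
  by rewrite size_tuple -{2}(size_tuple u) index_mem mem_linorder.
have inj : injective (fun x => nth x v (index x u)).
  move=> x y /=; rewrite [RHS](set_nth_default x) // => /eqP.
  rewrite nth_uniq ?linorder_uniq // => /eqP.
  by move=> /(index_inj x); apply; apply: mem_linorder.
exists (perm inj); do 2!apply: val_inj; rewrite /=.
have szE : size (map (perm inj) u) = size v by rewrite size_map !size_tuple.
case: (pickP (mem A)) => [a _|A0]; last first.
  have v0 : size v = 0 by rewrite size_tuple; apply: eq_card0.
  by rewrite [RHS](size0nil v0); apply: size0nil; rewrite szE.
apply: (@eq_from_nth _ a) => [//|i].
rewrite size_map => ltiu; rewrite (nth_map a) // permE.
rewrite index_uniq ?linorder_uniq //; apply: set_nth_default.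
by rewrite size_tuple -(size_tuple u).
Qed.

Lemma relabel_fix g w : relabel g w = w -> g = 1%g.
Proof.
move/(congr1 (fun u : linorder A => path_of u : seq A)) => /= E.
apply/permP=> x; rewrite perm1; have xw := mem_linorder w x.
have lt : index x w < size w by rewrite index_mem.
by have := congr1 (nth x ^~ (index x w)) E; rewrite /= (nth_map x) // nth_index.
Qed.

Lemma first_inP w x :
  reflect (forall y, y != x -> prefers w x y) (first_in w x).
Proof.
rewrite /first_in /prefers; have: x \in (path_of w : seq A) := mem_linorder w x.
case: (path_of w : seq A) => [|a s /= _] //.
apply: (iffP eqP) => [-> y /negbTE neq|].
  by rewrite eqxx (eq_sym x) neq.
by move=> /(_ a); case: (eqVneq a x) => [//|_ /(_ isT)]; rewrite eqxx.
Qed.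

Lemma last_inP w x :
  reflect (forall y, y != x -> prefers w y x) (last_in w x).
Proof.
have lastP l : last x w = l -> forall y, y != l -> prefers w y l.
  move=> <- y; rewrite eq_sym => neq_y; rewrite -(prefersN _ neq_y).
  have: y \in (path_of w : seq A) := mem_linorder w y.
  have := linorder_uniq w; rewrite /prefers.
  case: (path_of w : seq A) => [|a s] // uw yw; rewrite -leqNgt /=.
  have /= -> := index_last uw.
  by have: index y (a :: s) < size (a :: s) by rewrite index_mem.
apply: (iffP eqP) => [/lastP//|lastx].
apply/eqP/contraT => neq; have := lastP _ erefl x.
by rewrite eq_sym neq => /(_ isT) /prefers_asym[]; apply: lastx.
Qed.

Lemma first_in_exists w x : exists y, first_in w y.
Proof.
have [y _ ymin] := @arg_minnP _ x predT (fun y => index y w) isT.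
exists y; apply/first_inP => z neq_zy.
by rewrite -prefersN // /prefers -leqNgt; apply: ymin.
Qed.

Lemma first_in_inj w x y : first_in w x -> first_in w y -> x = y.
Proof.
move=> /first_inP wx /first_inP wy; apply/eqP/contraT => neq.
by case: (prefers_asym (wy _ neq)); apply: wx; rewrite eq_sym.
Qed.

Lemma first_last_card w x : first_in w x -> last_in w x -> #|A| <= 1.
Proof.
move=> /first_inP wx /last_inP xw; apply/card_le1_eqP => y z _ _.
have only t : t = x.
  by apply/eqP/contraT => neq; case: (prefers_asym (wx _ neq) (xw _ neq)).
by rewrite (only y) (only z).
Qed.

Lemma linorder_of_seq (s : seq A) :
  uniq s -> size s = #|A| -> exists w : linorder A, path_of w = s :> seq A.
Proof.
move=> us /eqP szs; have ut : uniq (Tuple szs) by [].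
by exists (LinOrder ut).
Qed.

Lemma linorder_inhabited : exists w : linorder A, True.
Proof.
have [w _] := linorder_of_seq (enum_uniq A) (esym (cardE A)).
by exists w.
Qed.

(** Orders are built from pieces of other orders by computing ranks, which
    avoids handling the underlying sequences. *)
Lemma linorder_of_rank (k : A -> nat) :
  injective k -> exists w, forall x y, prefers w x y = (k x < k y).
Proof.
move=> k_inj; pose r x y := k x <= k y.
have r_tr : transitive r by move=> y x z; apply: leq_trans.
have r_tot : total r by move=> x y; apply: leq_total.
have us : uniq (sort r (enum A)) by rewrite sort_uniq enum_uniq.
have [|w Ew] := linorder_of_seq us; first by rewrite size_sort cardE.
have wk x y : prefers w x y -> k x < k y.
  move=> xy; rewrite ltn_neqAle (inj_eq k_inj) (prefers_neq xy).
  apply: (sorted_ltn_index r_tr (s := w)); rewrite ?mem_linorder //.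
  by rewrite Ew sort_sorted.
exists w => x y; apply/idP/idP => [/wk//|kxy].
rewrite -prefersN; first by apply/negP => /wk/ltnW; rewrite leqNgt kxy.
by apply: contraTneq kxy => ->; rewrite ltnn.
Qed.

(** The witness sorts the elements from the top of [v] down to [x] as [u] does
    and keeps the part of [v] below [x]. *)
Lemma splice_exists u v x :
  exists w, forall y z, prefers w y z =
    if prefers v x z then prefers v y z else ~~ prefers v x y && prefers u y z.
Proof.
pose k y := if prefers v x y then #|A| + index y v else index y u.
have ltA w y : index y w < #|A|.
  have lt : index y w < size w by rewrite index_mem mem_linorder.
  by rewrite size_tuple in lt.
have k_inj : injective k.
  move=> y z; rewrite /k; case: ifP => _; case: ifP => _.
  - by move/addnI=> /(index_inj y); apply; apply: mem_linorder.
  - by move=> E; have := ltA u z; rewrite -E ltnNge leq_addr.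
  - by move=> E; have := ltA u y; rewrite E ltnNge leq_addr.
  - by move=> /(index_inj y); apply; apply: mem_linorder.
have [w wk] := linorder_of_rank k_inj; exists w => y z; rewrite wk /k.
case: (boolP (prefers v x z)) => xz; case: (boolP (prefers v x y)) => xy /=.
- by rewrite ltn_add2l.
- rewrite (leq_trans (ltA _ _)) ?leq_addr //; apply/esym.
  by move: xy xz; rewrite /prefers -leqNgt; apply: leq_ltn_trans.
- by rewrite ltnNge (leq_trans (ltnW (ltA _ _))) ?leq_addr.
- by [].
Qed.

Lemma last_among w (P : pred A) x :
  P x -> exists2 z, P z & forall y, P y -> y != z -> prefers w y z.
Proof.
move=> Px; have [z Pz max_z] := arg_maxnP (fun y => index y w) Px.
exists z => // y Py neq_yz.
by rewrite -prefersN 1?eq_sym // /prefers -leqNgt; apply: max_z.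
Qed.

End Orders.

(** * The structure of maximal Arrow's single-peaked domains *)

Section Structure.

Variable A : finType.

Implicit Types (D E : {set linorder A}) (u v w : linorder A) (a b c x y z : A).

Definition bottom D x y z : Prop :=
  exists2 u, u \in D & prefers u y x /\ prefers u z x.

(** Never-bottom conditions in symmetric form: no triple has three bottoms. *)
Definition single_peaked D : Prop :=
  forall a b c, bottom D a b c -> bottom D b a c -> bottom D c a b -> False.

(** Reading [w] from the bottom, [x] is dropped when only the elements above it
    remain besides [x]; the domain allows this if some order has [x] last among
    them. *)
Definition droppable D w x : Prop :=
  exists2 u, u \in D & forall y, prefers w y x -> prefers u y x.

(** The orders [w] all of whose drops are possible are those whose upper sets
    belong to the convex geometry generated by [D], so this says that [D]
    contains all orders compatible with its geometry. *)
Definition drop_closed D : Prop :=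
  forall w, (forall x, droppable D w x) -> w \in D.

(** In terms of the convex geometry of [D]: a convex set with at least two
    elements, here the elements of [u] down to [x], has an extreme point [z]
    other than the one that [u] drops from it. *)
Definition full D : Prop :=
  forall u x y, u \in D -> prefers u y x ->
  exists z v, [/\ v \in D, prefers u z x
    & forall t, t != z -> ~~ prefers u x t -> prefers v t z].

Lemma bottomC D x y z : bottom D x y z -> bottom D x z y.
Proof. by case=> u uD [yx zx]; exists u. Qed.

Lemma bottom_neq D a b c :
  bottom D a b c -> bottom D b a c -> [/\ a != b, b != c & c != a].
Proof.
case=> [u _ [/prefers_neq neqba /prefers_neq neqca]].
by case=> v _ [_ /prefers_neq neqcb]; rewrite eq_sym neqba eq_sym neqcb neqca.
Qed.

Lemma droppable_mem D w x : w \in D -> droppable D w x.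
Proof. by exists w. Qed.

Lemma bottom_droppable D E a b c :
  (forall w x, w \in E -> droppable D w x) -> bottom E a b c -> bottom D a b c.
Proof.
move=> drop [w wE [ba ca]]; have [u uD wu] := drop w a wE.
by exists u; last split; auto.
Qed.

Lemma condorcetP D :
  reflect (forall w1 w2 w3 a b c, w1 \in D -> w2 \in D -> w3 \in D ->
     prefers w1 a b -> prefers w1 b c -> prefers w2 b c -> prefers w2 c a ->
     prefers w3 c a -> prefers w3 a b -> False) (condorcet D).
Proof.
apply: (iffP idP) => [/negP cD w1 w2 w3 a b c w1D w2D w3D ab bc bc' ca ca' ab'|cD].
  apply: cD; apply/exists_inP; exists w1 => //; apply/exists_inP; exists w2 => //.
  apply/exists_inP; exists w3 => //.
  apply/existsP; exists a; apply/existsP; exists b; apply/existsP; exists c.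
  rewrite ab bc bc' ca ca' ab' !andbT /= !inE negb_or (prefers_neq ab).
  by rewrite (prefers_neq bc) eq_sym (prefers_neq ca).
apply/negP=> /exists_inP[w1 w1D] /exists_inP[w2 w2D] /exists_inP[w3 w3D].
case/existsP=> a /existsP[b] /existsP[c].
case/and4P=> _ /andP[ab bc] /andP[bc' ca] /andP[ca' ab'].
exact: (cD w1 w2 w3 a b c).
Qed.

Lemma single_peaked_condorcet D : single_peaked D -> condorcet D.
Proof.
move=> spD; apply/condorcetP=> w1 w2 w3 a b c w1D w2D w3D ab bc bc' ca ca' ab'.
apply: (spD a b c).
- by exists w2 => //; split=> //; apply: prefers_trans ca.
- by exists w3 => //; split=> //; apply: prefers_trans ab'.
- by exists w1 => //; split=> //; apply: prefers_trans bc.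
Qed.

Lemma never_bottomPn D (T : {set A}) x y z :
  T = [set x; y; z] -> y != x -> z != x ->
  reflect (bottom D x y z) (~~ never_bottom D T x).
Proof.
move=> -> yx zx; rewrite /never_bottom !inE eqxx /=.
apply: (iffP forall_inPn) => [[u uD /exists_inPn nx]|[u uD [yu zu]]].
  exists u => //; split; rewrite -prefersN 1?eq_sym //; apply: nx.
    by rewrite !inE eqxx orbT.
  by rewrite !inE eqxx orbT.
exists u => //; apply/exists_inPn => t; rewrite !inE => /orP[/orP[]|] /eqP ->.
- by rewrite prefers_irr.
- by rewrite prefersN // eq_sym.
- by rewrite prefersN // eq_sym.
Qed.

Lemma arrow_single_peakedP D : reflect (single_peaked D) (arrow_single_peaked D).
Proof.
have setCA (a b c : A) : [set a; b; c] = [set b; a; c].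
  by rewrite [[set a; b]]setUC.
have setRot (a b c : A) : [set a; b; c] = [set c; a; b].
  by rewrite setUC setUA.
apply: (iffP andP) => [[_ /forall_inP spD] a b c Ba Bb Bc|spD]; last first.
  split; first exact: single_peaked_condorcet.
  apply/forall_inP => T /eqP T3; apply/contraT => /existsPn nT.
  have /card_gt2P[a [b [c [[aT bT cT] [ab bc ca]]]]] : 2 < #|T| by rewrite T3.
  have ET : T = [set a; b; c].
    apply/esym/eqP; rewrite eqEcard T3 !subUset !sub1set aT bT cT /=.
    by rewrite setUC cardsU1 cards2 !inE ab (negbTE ca) [c == b]eq_sym (negbTE bc).
  exfalso; apply: (spD a b c).
  - by apply: (elimT (never_bottomPn D ET _ _)); rewrite // eq_sym.
  - by apply: (elimT (@never_bottomPn D T b a c _ _ _)); rewrite // 1?eq_sym // ET setCA.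
  - by apply: (elimT (@never_bottomPn D T c a b _ _ _)); rewrite // 1?eq_sym // ET setRot.
have [ab bc ca] := bottom_neq Ba Bb.
have /existsP[x] : [exists x, never_bottom D [set a; b; c] x].
  apply: spD; rewrite setUC cardsU1 cards2 !inE ab (negbTE ca) [c == b]eq_sym.
  by rewrite (negbTE bc).
move=> nx; have := nx; case/andP; rewrite !inE => /orP[/orP[]|] /eqP Ex _.
- by move: nx; rewrite Ex; apply/negP; apply: (introT (never_bottomPn D _ _ _) Ba);
    rewrite // eq_sym.
- by move: nx; rewrite Ex; apply/negP; apply: (introT (@never_bottomPn D _ b a c _ _ _) Bb);
    rewrite // 1?eq_sym // setCA.
- by move: nx; rewrite Ex; apply/negP; apply: (introT (@never_bottomPn D _ c a b _ _ _) Bc);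
    rewrite // 1?eq_sym // setRot.
Qed.

Lemma maximal_single_peaked D :
  maximal_arrow_single_peaked D -> single_peaked D.
Proof. by case/andP=> /arrow_single_peakedP. Qed.

(** Being single-peaked implies being Condorcet, so a maximal domain absorbs any
    order that can be added while staying single-peaked. *)
Lemma maximal_absorbs D w :
  maximal_arrow_single_peaked D -> single_peaked (w |: D) -> w \in D.
Proof.
case/andP=> _ /maxsetP[_ maxD] /single_peaked_condorcet spwD.
by rewrite -(maxD _ spwD (subsetUr _ _)) setU11.
Qed.

(** The orders compatible with the geometry of [D] have no bottoms on triples
    that [D] does not already have. *)
Lemma maximal_drop_closed D : maximal_arrow_single_peaked D -> drop_closed D.
Proof.
move=> maxD w wD; apply: maximal_absorbs => //.
have spD := maximal_single_peaked maxD.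
have drop v x : v \in w |: D -> droppable D v x.
  by case/setU1P => [->|/droppable_mem].
by move=> a b c /(bottom_droppable drop) ? /(bottom_droppable drop) ?
  /(bottom_droppable drop); apply: spD.
Qed.

(** A single order is single-peaked, so the empty domain is not maximal. *)
Lemma maximal_inhabited D :
  maximal_arrow_single_peaked D -> exists w, w \in D.
Proof.
move=> maxD; have [D0|[w wD]] := set_0Vmem D; last by exists w.
have [w _] := linorder_inhabited A; exists w; apply: maximal_absorbs => //.
rewrite D0 setU0 => a b c [u /set1P-> [ba _]] [v /set1P->] [ab _].
by case: (prefers_asym ba ab).
Qed.

(** If [x] were the only bottom of the elements of [u] down to [x], then
    swapping [x] with its immediate predecessor [s] would give an order that can
    be added: only the triples [s], [x], [c] with [c] above [s] are affected, and there
    [c] never is a bottom as it comes before [x] throughout the domain. *)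
Lemma maximal_full D : maximal_arrow_single_peaked D -> full D.
Proof.
move=> maxD u x y uD yx; have spD := maximal_single_peaked maxD.
case: (boolP [forall v in D, forall t, prefers u t x ==> prefers v t x]); last first.
  move=> /forall_inPn[v vD /forallPn[t]]; rewrite negb_imply => /andP[tux ntvx].
  have [z zux zlast] := @last_among _ v (fun z => ~~ prefers u x z) x
    (negbT (prefers_irr u x)).
  have neq_zx : z != x.
    apply: contraNneq ntvx => Ezx; rewrite -Ezx; apply: zlast.
      by apply/negP => /(prefers_asym tux).
    by rewrite Ezx (prefers_neq tux).
  exists z, v; split=> // [|t' neq_t' ut']; last exact: zlast.
  by rewrite -prefersN // eq_sym.
move=> /forall_inP xlast.
have {}xlast v t : v \in D -> prefers u t x -> prefers v t x.
  by move=> vD; have /forallP/(_ t)/implyP := xlast v vD.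
(* [s] immediately precedes [x] in [u] *)
have [s sx adj] := @last_among _ u (fun t => prefers u t x) y yx.
pose w := relabel (tperm s x) u.
have wE b a : prefers w b a -> prefers u b a \/ b = x /\ a = s.
  rewrite prefers_relabel_tperm.
  case: (tpermP s x b) => [->|->|neq_bs neq_bx];
    case: (tpermP s x a) => [->|->|neq_as neq_ax]; rewrite ?prefers_irr; auto.
  - by move=> xa; left; apply: prefers_trans xa.
  - move=> sa; left; rewrite -prefersN; last by apply/eqP.
    apply/negP=> ax; apply: (prefers_asym sa).
    by apply: adj => //; apply/eqP.
  - by move=> bx; left; apply: adj => //; apply/eqP.
  - by move=> bs; left; apply: prefers_trans sx.
suff wD : w \in D.
  by have := xlast w s wD sx; rewrite prefers_relabel_tperm tpermL tpermR =>
    /(prefers_asym sx).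
apply: maximal_absorbs => //.
(* a bottom shown by [w] only is [s], in a triple that contains [x] *)
have Ew a b c : bottom (w |: D) a b c -> bottom D a b c \/
    a = s /\ (b = x /\ prefers w c s \/ c = x /\ prefers w b s).
  case=> v /setU1P[->|vD] [ba ca]; last by left; exists v.
  case: (wE _ _ ba) => [uba|[bx as_]]; last by right; rewrite -as_; auto.
  case: (wE _ _ ca) => [uca|[cx as_]]; last by right; rewrite -as_; auto.
  by left; exists u.
have Es t : prefers w t s -> ~ bottom (w |: D) t s x.
  move=> ts [v /setU1P[->|vD] [st xt]]; first exact: (prefers_asym st ts).
  apply: (prefers_asym xt); apply: xlast => //.
  case: (wE _ _ ts) => [uts|[tx _]]; first exact: prefers_trans sx.
  by move: xt; rewrite tx prefers_irr.
move=> a b c Ba Bb Bc.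
case: (Ew _ _ _ Ba) => [Da|[as_ [[bx /Es]|[cx /Es]]]]; last first.
- by apply; rewrite -as_ -cx.
- by apply; rewrite -as_ -bx.
case: (Ew _ _ _ Bb) => [Db|[bs [[ax /Es]|[cx /Es]]]]; last first.
- by apply; apply: bottomC; rewrite -bs -cx; apply: bottomC; rewrite bs cx in Ba *.
- by apply; apply: bottomC; rewrite -bs -ax.
case: (Ew _ _ _ Bc) => [Dc|[cs [[ax /Es]|[bx /Es]]]]; last first.
- by apply; apply: bottomC; rewrite -cs -bx.
- by apply; apply: bottomC; rewrite -cs -ax.
exact: (spD a b c).
Qed.

Lemma drop_closed_splice D u v x :
  drop_closed D -> u \in D -> v \in D -> exists2 w, w \in D &
    forall y z, prefers w y z =
      if prefers v x z then prefers v y z else ~~ prefers v x y && prefers u y z.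
Proof.
move=> clD uD vD; have [w Ew] := splice_exists u v x; exists w => //.
apply: clD => z; case: (boolP (prefers v x z)) => xz.
  by exists v => // y; rewrite Ew xz.
by exists u => // y; rewrite Ew (negbTE xz) => /andP[].
Qed.

(** A second bottom besides [x] can be realised without touching the part of [u]
    below [x]. *)
Lemma drop_closed_full_splice D u x y :
  drop_closed D -> full D -> u \in D -> prefers u y x ->
  exists z v, [/\ v \in D, prefers u z x,
    forall t, t != z -> ~~ prefers u x t -> prefers v t z
    & forall t t', prefers u x t' -> prefers v t t' = prefers u t t'].
Proof.
move=> clD fuD uD yx; have [z [v [vD zx zlast]]] := fuD u x y uD yx.
have [w wD Ew] := drop_closed_splice x clD vD uD; exists z, w.
split=> // [t neq_tz xt|t t' xt']; last by rewrite Ew xt'.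
rewrite Ew xt zlast // andbT.
by case: ifP => // /(prefers_asym zx).
Qed.

(** Restricted to a triple, the domain is as rich as a never-bottom condition
    allows: below an order with [r] last, both orders of the other two occur.
    The order is changed above the lower of [p] and [q] until these two are the
    two bottoms of the elements not yet dropped. *)
Lemma drop_closed_full_copious D v p q r :
  drop_closed D -> full D -> v \in D -> p != q -> prefers v p r -> prefers v q r ->
  exists2 u, u \in D & prefers u p q /\ prefers u q r.
Proof.
move=> clD fuD + neq_pq.
pose S w := [set t | ~~ (prefers w p t && prefers w q t)].
have [n] := ubnP #|S v|; elim: n v => // n IHn v.
move=> ltS vD pr qr; have /orP[pq|qp] := prefers_total v neq_pq; first by exists v.
have [z [w [wD zp zlast wE]]] := drop_closed_full_splice clD fuD vD qp.
have [Ez|neq_zq] := eqVneq z q.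
  exists w; rewrite // -Ez zlast ?prefers_irr //; last by rewrite Ez.
  by rewrite wE // Ez.
have pz : prefers w p z.
  by apply: zlast; rewrite ?prefers_irr // eq_sym (prefers_neq zp).
have qz : prefers w q z.
  by apply: zlast; [rewrite eq_sym | apply/negP => /(prefers_asym qp)].
apply: (IHn w); rewrite ?wE //.
apply: (@leq_trans #|S v|); last by [].
apply/proper_card/properP; split; last first.
  exists z; rewrite !inE ?pz ?qz // negb_and.
  by apply/orP; left; apply/negP => /(prefers_asym zp).
apply/subsetP => t; rewrite !inE; apply: contraNN => /andP[pt qt].
by rewrite !wE // pt qt.
Qed.

(** A new order would put the wrong element last in some triple, and this triple
    is rich enough in the domain to complete a cycle. *)
Lemma drop_closed_full_maximal D :
  (exists w, w \in D) -> single_peaked D -> drop_closed D -> full D ->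
  maximal_arrow_single_peaked D.
Proof.
move=> [w0 w0D] spD clD fuD; apply/andP; split; first exact/arrow_single_peakedP.
apply/maxsetP; split=> [|E /condorcetP cE /subsetP sDE].
  exact: single_peaked_condorcet.
apply/eqP; rewrite eqEsubset andbC; apply/andP; split; first exact/subsetP.
apply/subsetP => w wE; apply: (clD) => x.
have [n] := ubnP #|[set t | prefers w x t]|; elim: n x => // n IHn x.
move=> leSn; have {IHn leSn} IH t : prefers w x t -> droppable D w t.
  move=> xt; apply: IHn; apply: leq_trans (leSn : _ <= n); apply/proper_card/properP.
  split; last by exists t; rewrite !inE ?prefers_irr.
  by apply/subsetP => t'; rewrite !inE; apply: prefers_trans.
(* an order of [D] that agrees with [w] below [x] *)
have [v vE] := splice_exists w0 w x.
have vD : v \in D.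
  apply: clD => z; case: (boolP (prefers w x z)) => xz.
    by have [u uD wu] := IH z xz; exists u => // y; rewrite vE xz; apply: wu.
  by exists w0 => // y; rewrite vE (negbTE xz) => /andP[].
case: (boolP [forall t, prefers w t x ==> prefers v t x]) => [/forallP vx|].
  by exists v => // t; apply/implyP.
case/forallPn=> t; rewrite negb_imply => /andP[tx nvtx].
have xv : prefers v x t by rewrite -prefersN // (prefers_neq tx).
have nxx : ~~ prefers w x x by rewrite prefers_irr.
have [a nxa alast] := @last_among _ v (fun z => ~~ prefers w x z) x nxx.
have xa : prefers v x a.
  have [<-//|neq_ta] := eqVneq t a; apply: prefers_trans xv _.
  by apply: alast => //; apply/negP => /(prefers_asym tx).
have [b [v' [v'D ba blast]]] := fuD v a x vD xa.
have nva z : prefers w z x -> ~~ prefers v a z.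
  move=> zx; have [->|neq_za] := eqVneq z a; first by rewrite prefers_irr.
  apply/negP => /prefers_asym; apply; apply: alast => //.
  by apply/negP => /(prefers_asym zx).
have [Eb|neq_bx] := eqVneq b x.
  exists v' => // z zx; rewrite -Eb; apply: blast; last exact: nva.
  by rewrite Eb (prefers_neq zx).
exfalso; have wa : prefers w a x by rewrite -prefersN // (prefers_neq xa).
have wb : prefers w b x.
  rewrite -prefersN 1?eq_sym //; apply/negP => xb; apply: (prefers_asym ba).
  by rewrite vE xb; apply: prefersNN xb.
have neq_ab : a != b by rewrite eq_sym (prefers_neq ba).
have v'a : prefers v' a b by apply: blast; rewrite ?prefers_irr.
have v'x : prefers v' x b.
  by apply: blast; [rewrite eq_sym | apply/negP => /(prefers_asym xa)].
have neq_ax : a != x by rewrite eq_sym (prefers_neq xa).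
(* [a] and [b] are the two bottoms of a set that contains [x], which [w] puts
   last among the three; [D] contains all four orders that do not *)
have [u1 u1D [u1b u1x]] := drop_closed_full_copious clD fuD vD neq_bx ba xa.
have [u2 u2D [u2x u2b]] : exists2 u, u \in D & prefers u x b /\ prefers u b a.
  by apply: (drop_closed_full_copious clD fuD vD) => //; rewrite eq_sym.
have [u3 u3D [u3a u3x]] := drop_closed_full_copious clD fuD v'D neq_ax v'a v'x.
have [u4 u4D [u4x u4a]] : exists2 u, u \in D & prefers u x a /\ prefers u a b.
  by apply: (drop_closed_full_copious clD fuD v'D) => //; rewrite eq_sym.
have /orP[ab|ab] := prefers_total w neq_ab.
  by apply: (cE w u1 u4 a b x) => //; apply: sDE.
by apply: (cE w u3 u2 b a x) => //; apply: sDE.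
Qed.

End Structure.

(** * Domains with trivial permutation *)

Section Mirror.

Variable A : finType.

Implicit Types (D : {set linorder A}) (P Q W : linorder A) (s f x y : A).

(** For a single-peaked [D] this makes [P] and its image the two extremal paths
    (see [mirrored_extremal]), with trivial permutation. *)
Definition mirrored D s f P : Prop :=
  [/\ first_in P s, last_in P f, P \in D & relabel (tperm s f) P \in D].

Lemma first_in_relabel (g : {perm A}) P s :
  first_in P s -> first_in (relabel g P) (g s).
Proof.
move=> /first_inP Ps; apply/first_inP => y.
by rewrite -{1 2}(permKV g y) (inj_eq perm_inj) prefers_relabel => /Ps.
Qed.

Lemma last_in_relabel (g : {perm A}) P s :
  last_in P s -> last_in (relabel g P) (g s).
Proof.
move=> /last_inP Ps; apply/last_inP => y.
by rewrite -{1 2}(permKV g y) (inj_eq perm_inj) prefers_relabel => /Ps.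
Qed.

Lemma relabel_tpermK s f : involutive (relabel (tperm s f)).
Proof. by move=> W; rewrite -relabelM tperm2 relabel1. Qed.

Lemma mirrored_sym D s f P :
  mirrored D s f P -> mirrored D f s (relabel (tperm s f) P).
Proof.
case=> Ps Pf PD QD; split=> //; last by rewrite [tperm f s]tpermC relabel_tpermK.
  by rewrite -{2}[f](tpermL s) first_in_relabel.
by rewrite -{2}[s](tpermR _ f) last_in_relabel.
Qed.

(** Once the other bottom of each set containing [s] is known from [P], an order
    of the domain has to agree with [P] for as long as [s] has not been
    dropped. *)
Lemma tail_forced D P Q W s x y :
  single_peaked D -> P \in D -> Q \in D -> W \in D ->
  first_in P s -> last_in Q s ->
  prefers W s x -> prefers W y x -> prefers P y x.
Proof.
move=> spD PD QD WD /first_inP Ps /last_inP Qs sx yx.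
have neq_xs : x != s by rewrite eq_sym (prefers_neq sx).
have [->|neq_ys] := eqVneq y s; first exact: Ps.
rewrite -prefersN 1?eq_sym ?(prefers_neq yx) //; apply/negP => xy.
apply: (spD s y x).
- by exists Q => //; split; apply: Qs.
- by exists P => //; split=> //; apply: Ps.
- by exists W.
Qed.

(** A third terminal element would form a triple of bottoms with [s] and [f]. *)
Lemma mirrored_terminal D s f P x :
  single_peaked D -> s != f -> mirrored D s f P -> terminal D x ->
  x = s \/ x = f.
Proof.
move=> spD neq_sf mir /exists_inP[W WD /last_inP Wx].
have [_ /last_inP Qs QD _] := mirrored_sym mir.
have [_ /last_inP Pf PD _] := mir.
case: (eqVneq x s) => [|neq_xs]; first by left.
case: (eqVneq x f) => [|neq_xf]; first by right.
case: (spD x s f).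
- by exists W => //; split; apply: Wx; rewrite eq_sym.
- by exists (relabel (tperm s f) P) => //; split; apply: Qs; rewrite // eq_sym.
- by exists P => //; split; apply: Pf.
Qed.

(** An order of the domain that starts at [s] keeps [s] to the end, so all of it
    is forced. *)
Lemma mirrored_extremal D s f P :
  single_peaked D -> s != f -> mirrored D s f P ->
  [set W | extremal D W] = [set P; relabel (tperm s f) P].
Proof.
move=> spD neq_sf mir; have mir' := mirrored_sym mir.
have [Ps Pf PD QD] := mir; have [Qf Qs _ _] := mir'.
have ext s' f' P' : s' != f' -> mirrored D s' f' P' -> extremal D P'.
  move=> neq' mir''; have [Ps' Pf' PD' _] := mir''.
  have [_ Qs' QD' _] := mirrored_sym mir''.
  rewrite /extremal PD'; apply/existsP; exists s'; apply/existsP; exists f'.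
  rewrite neq' Ps' Pf' /= andbT.
  by apply/andP; split; apply/exists_inP; [exists (relabel (tperm s' f') P')|exists P'].
have uniq_ext s' f' P' W : mirrored D s' f' P' -> W \in D -> first_in W s' -> W = P'.
  move=> mir'' WD /first_inP Ws; have [Ps' _ PD' _] := mir''.
  have [_ Qs' QD' _] := mirrored_sym mir''.
  apply: linorder_inj => x y xy; apply: (tail_forced spD PD' QD' WD Ps' Qs') => //.
  apply: (Ws); apply/eqP => Ey; rewrite Ey in xy.
  exact: (prefers_asym xy (Ws _ (prefers_neq xy))).
apply/setP=> W; rewrite !inE; apply/idP/orP => [|[/eqP->|/eqP->]]; last 1 first.
- by apply: (ext f s) => //; rewrite eq_sym.
- case/andP=> WD /existsP[a /existsP[b /and5P[ta tb neq_ab Wa Wb]]].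
  have [Ea|Ea] := mirrored_terminal spD neq_sf mir ta; [left|right]; apply/eqP.
    by apply: (uniq_ext s f) => //; rewrite -Ea.
  by apply: (uniq_ext f s) => //; rewrite -Ea.
- exact: (ext s f).
Qed.

Lemma mirrored_is_sigma D s f P :
  single_peaked D -> s != f -> mirrored D s f P -> is_sigma D s f 1%g.
Proof.
move=> spD neq_sf mir.
rewrite /is_sigma perm_on1 /=; apply/existsP; exists P.
apply/existsP; exists (relabel (tperm s f) P).
have [Ps Pf _ _] := mir.
by rewrite (mirrored_extremal spD neq_sf mir) mulg1 Ps Pf !eqxx.
Qed.

(** The upper sets of [W] containing [s] but not [f] are upper sets of [P], and
    the transposition carries them to upper sets of its image; those containing
    neither do not move. So each element can be dropped from the image of [W] at
    its turn. *)
Lemma mirrored_stable D s f P W :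
  single_peaked D -> drop_closed D -> mirrored D s f P ->
  W \in D -> relabel (tperm s f) W \in D.
Proof.
move=> spD clD mir WD; have [Ps Pf PD QD] := mir.
have [Qf Qs _ _] := mirrored_sym mir; set Q := relabel _ P in QD Qf Qs.
apply: clD => x.
have [->|neq_xs] := eqVneq x s.
  by exists Q => // y /prefers_neq; apply/last_inP.
have [->|neq_xf] := eqVneq x f.
  by exists P => // y /prefers_neq; apply/last_inP.
have tx : tperm s f x = x by rewrite tpermD // eq_sym.
case: (boolP (prefers W s x)) => sx.
  exists Q => // y; rewrite !prefers_relabel_tperm tx.
  exact: (tail_forced spD PD QD WD Ps Qs).
case: (boolP (prefers W f x)) => fx.
  exists P => // y; rewrite prefers_relabel_tperm tx.
  move=> /(tail_forced spD QD PD WD Qf Pf fx).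
  by rewrite prefers_relabel_tperm tx tpermK.
exists W => // y; rewrite prefers_relabel_tperm tx.
by case: tpermP => // ->; rewrite ?(negbTE sx) ?(negbTE fx).
Qed.

Lemma sigma_trivialP D :
  single_peaked D -> 2 <= #|A| ->
  reflect (exists s f P, s != f /\ mirrored D s f P) (sigma_trivial D).
Proof.
move=> spD A2; apply: (iffP idP) => [/existsP[s /existsP[f /andP[_]]]|].
  move=> /existsP[P /existsP[Q /and4P[/eqP E Ps Pf /eqP EQ]]].
  exists s, f, P; split.
    apply: contraTneq A2 => Esf; rewrite -leqNgt.
    by apply: first_last_card Ps _; rewrite Esf.
  move: EQ; rewrite mulg1 => EQ; split=> //.
    by have := set21 P Q; rewrite -E inE => /andP[].
  by rewrite -EQ; have := set22 P Q; rewrite -E inE => /andP[].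
move=> [s [f [P [neq_sf mir]]]]; apply/existsP; exists s; apply/existsP; exists f.
exact: (mirrored_is_sigma spD neq_sf mir).
Qed.

Lemma mirrored_self_paired D s f P :
  single_peaked D -> drop_closed D -> s != f -> mirrored D s f P -> self_paired D.
Proof.
move=> spD clD neq_sf mir; apply/existsP; exists (tperm s f); apply/andP; split.
  apply/existsP; exists s; apply/existsP; exists f; apply/existsP; exists 1%g.
  by rewrite mulg1 eqxx andbT (mirrored_is_sigma spD neq_sf mir).
rewrite eqEcard card_imset ?leqnn ?andbT; last exact: can_inj (relabelK _).
apply/subsetP => _ /imsetP[W WD ->]; exact: (mirrored_stable spD clD mir).
Qed.

End Mirror.

(** * Doubling a domain on one element fewer *)

Section Doubling.

Variables (A B : finType) (i : B -> A) (f : A).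
Hypotheses (i_inj : injective i) (i_neq : forall b, i b != f).
Hypothesis cardA : #|A| = #|B|.+1.

Implicit Types (D : {set linorder B}) (E : {set linorder A}) (u v : linorder B)
  (V W : linorder A) (b c : B) (x y : A).

Lemma extend_size u : size (rcons (map i u) f) == #|A|.
Proof. by rewrite size_rcons size_map size_tuple cardA. Qed.

Lemma extend_uniq u : uniq (Tuple (extend_size u)).
Proof.
rewrite /= rcons_uniq map_inj_uniq ?linorder_uniq // andbT.
by apply/mapP => -[b _ Ef]; have := i_neq b; rewrite -Ef eqxx.
Qed.

Definition extend u : linorder A := LinOrder (extend_uniq u).

Lemma embedP x : x != f -> exists b, x = i b.
Proof.
move=> neq_xf; apply/codomP; suff ->: codom i =i [set~ f] by rewrite !inE.
apply/subset_cardP; first by rewrite (card_codom i_inj) cardsC1 cardA.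
by apply/subsetP => _ /codomP[b ->]; rewrite !inE.
Qed.

Lemma prefers_extend u b c : prefers (extend u) (i b) (i c) = prefers u b c.
Proof.
have ib d : index (i d) (extend u) = index d u.
  rewrite /= -cats1 index_cat map_f ?index_map //; exact: mem_linorder.
by rewrite /prefers !ib.
Qed.

Lemma extend_last u : last_in (extend u) f.
Proof. by rewrite /last_in /= last_rcons. Qed.

Lemma prefers_extend_last u x : prefers (extend u) f x = false.
Proof.
have [->|neq_xf] := eqVneq x f; first by rewrite prefers_irr.
by apply/negP => /prefers_asym; apply; apply: (last_inP _ _ (extend_last u)).
Qed.

Lemma extend_first u b : first_in u b -> first_in (extend u) (i b).
Proof.
move=> /first_inP ub; apply/first_inP => x neq.
have [->|/embedP[c Ex]] := eqVneq x f.
  by apply: (last_inP _ _ (extend_last u)).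
by rewrite Ex prefers_extend; apply: ub; apply: contraNneq neq => <-; rewrite Ex.
Qed.

Lemma extend_inj : injective extend.
Proof. by move=> u v E; apply: linorder_inj => b c; rewrite -!prefers_extend E. Qed.

Lemma last_in_extend W : last_in W f -> exists u, W = extend u.
Proof.
move=> /last_inP Wf.
have k_inj : injective (fun b => index (i b) W).
  by move=> b c /(index_inj f (mem_linorder W _) (mem_linorder W _)) /i_inj.
have [u Eu] := linorder_of_rank k_inj; exists u.
apply: linorder_inj => x y xy; have neq_xf : x != f.
  apply: contraTneq xy => ->; apply/negP => fy.
  by apply: (prefers_asym fy); apply: Wf; rewrite eq_sym (prefers_neq fy).
have [b Ex] := embedP neq_xf; have [Ey|/embedP[c Ey]] := eqVneq y f.
  by rewrite Ey; apply: (last_inP _ _ (extend_last u)).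
by move: xy; rewrite Ex Ey prefers_extend Eu.
Qed.

Variable s0 : B.

Let s := i s0.
Let t := tperm s f.

(** The orders ending with [f] determine the domain, because those ending with
    [s] have to be their images under the transposition ([mirrored_stable]). *)
Definition doubling D : {set linorder A} :=
  extend @: D :|: relabel t @: (extend @: D).

Lemma doublingP D W :
  reflect (exists2 u, u \in D & W = extend u \/ W = relabel t (extend u))
          (W \in doubling D).
Proof.
apply: (iffP setUP) => [[/imsetP[u uD ->]|/imsetP[_ /imsetP[u uD ->] ->]]|].
- by exists u; auto.
- by exists u; auto.
- by case=> u uD [->|->]; [left | right]; rewrite ?imset_f.
Qed.

Lemma doubling_swap D W : (relabel t W \in doubling D) = (W \in doubling D).
Proof.
have swap V : V \in doubling D -> relabel t V \in doubling D.
  case/doublingP=> u uD EV; apply/doublingP; exists u => //.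
  by case: EV => ->; [right | left; rewrite relabel_tpermK].
by apply/idP/idP => [/swap|/swap//]; rewrite relabel_tpermK.
Qed.

Lemma mem_doubling D u : (extend u \in doubling D) = (u \in D).
Proof.
apply/doublingP/idP => [[v vD [/extend_inj->//|Eu]]|uD]; last by exists u; auto.
have := last_inP _ _ (extend_last u) s (i_neq s0).
rewrite Eu prefers_relabel_tperm tpermL tpermR.
by rewrite prefers_extend_last.
Qed.

Lemma doubling_inj : injective doubling.
Proof. by move=> D1 D2 E; apply/setP=> u; rewrite -!mem_doubling E. Qed.

Lemma doubling_last D W x : W \in doubling D -> last_in W x -> x = s \/ x = f.
Proof.
case/doublingP=> u uD EW /last_inP Wx.
suff lastW z : last_in W z -> x = z.
  case: EW => EW; [right | left]; apply: lastW; rewrite EW ?extend_last //.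
  by have := last_in_relabel t (extend_last u); rewrite tpermR.
move=> /last_inP Wz; apply/eqP/contraT => neq.
by case: (prefers_asym (Wz _ neq)); apply: Wx; rewrite eq_sym.
Qed.

(** Orders ending with [s] show no bottoms inside the smaller set beyond those
    of [D]: there [f] stands for [s0], and the only element that moves down is
    [s0] itself, which is terminal. *)
Lemma doubling_restrict D W b :
  terminal D s0 -> W \in doubling D ->
  exists2 v, v \in D & forall c, prefers W (i c) (i b) -> prefers v c b.
Proof.
move=> /exists_inP[z zD /last_inP zs0] /doublingP[u uD [->|->]].
  by exists u => // c; rewrite prefers_extend.
have [->|neq_b] := eqVneq b s0.
  exists z => // c; rewrite prefers_relabel_tperm => /prefers_neq.
  by rewrite (inj_eq perm_inj) (inj_eq i_inj); apply: zs0.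
exists u => // c; rewrite prefers_relabel_tperm.
rewrite [in X in prefers _ _ X]tpermD ?[f == _]eq_sym ?(inj_eq i_inj) // 1?eq_sym //.
case: tpermP => [|Ef|_ _]; last by rewrite prefers_extend.
  by rewrite prefers_extend_last.
by have := i_neq c; rewrite Ef eqxx.
Qed.

Lemma doubling_bottom D a b c :
  terminal D s0 -> bottom (doubling D) (i a) (i b) (i c) -> bottom D a b c.
Proof.
move=> ts [W WD [ba ca]]; have [v vD Wv] := doubling_restrict a ts WD.
by exists v; last split; auto.
Qed.

Lemma doubling_bottom_swap D x y z :
  bottom (doubling D) x y z -> bottom (doubling D) (t x) (t y) (t z).
Proof.
case=> W WD [yx zx]; exists (relabel t W); rewrite ?doubling_swap //.
by rewrite !prefers_relabel.
Qed.

(** A triple avoiding [f] is handled in [D], a triple avoiding [s] by the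
    transposition, and in a triple with [s] and [f] the third element never is a
    bottom because every order ends with [s] or [f]. *)
Lemma doubling_single_peaked D :
  terminal D s0 -> single_peaked D -> single_peaked (doubling D).
Proof.
move=> ts spD.
have no_f x y z : x != f -> y != f -> z != f -> bottom (doubling D) x y z ->
    bottom (doubling D) y x z -> bottom (doubling D) z x y -> False.
  move=> /embedP[a ->] /embedP[b ->] /embedP[c ->].
  by do 3!move=> /(doubling_bottom ts) ?; apply: (spD a b c).
have no_s x y z : x != s -> y != s -> z != s -> bottom (doubling D) x y z ->
    bottom (doubling D) y x z -> bottom (doubling D) z x y -> False.
  move=> xs ys zs; do 3!move=> /doubling_bottom_swap ?.
  have tf e : e != s -> t e != f.
    by move=> es; rewrite -(tpermL s f) (inj_eq perm_inj).
  by apply: (no_f (t x) (t y) (t z)) => //; apply: tf.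
have sf x : ~ bottom (doubling D) x s f.
  case=> W WD [sx fx]; have [l _ Wl] := @last_among _ W predT x isT.
  have lastW : last_in W l by apply/last_inP => y; apply: Wl.
  have {}Wl y : y != l -> prefers W y l by apply: Wl.
  have [El|El] := doubling_last WD lastW; rewrite El in Wl.
    by apply: (prefers_asym sx); apply: Wl; rewrite eq_sym (prefers_neq sx).
  by apply: (prefers_asym fx); apply: Wl; rewrite eq_sym (prefers_neq fx).
move=> x y z Bx By Bz.
case: (boolP ((x == f) || (y == f) || (z == f))) => [Hf|]; last first.
  by rewrite !negb_or => /andP[/andP[xf yf] zf]; apply: (no_f x y z).
case: (boolP ((x == s) || (y == s) || (z == s))) => [Hs|]; last first.
  by rewrite !negb_or => /andP[/andP[xs ys] zs]; apply: (no_s x y z).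
have neq_fs : (f == s) = false by apply/negbTE; rewrite eq_sym i_neq.
case/orP: Hf => [/orP[]|] /eqP E; rewrite E ?neq_fs ?orbF /= in Hs Bx By Bz;
  case/orP: Hs => /eqP E'; rewrite E' in Bx By Bz.
- exact: sf (bottomC Bz).
- exact: sf (bottomC By).
- exact: sf Bz.
- exact: sf (bottomC Bx).
- exact: sf By.
- exact: sf Bx.
Qed.

Lemma doubling_drop_closed D :
  terminal D s0 -> drop_closed D -> drop_closed (doubling D).
Proof.
move=> ts clD.
have clf W : (forall x, droppable (doubling D) W x) -> last_in W f ->
    W \in doubling D.
  move=> dropW /last_in_extend[u Eu]; rewrite Eu mem_doubling; apply: clD => b.
  have [V VD WV] := dropW (i b); have [v vD Vv] := doubling_restrict b ts VD.
  by exists v => // c ub; apply/Vv/WV; rewrite Eu prefers_extend.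
move=> W dropW; have [l _ Wl] := @last_among _ W predT f isT.
have lastW : last_in W l by apply/last_inP => y; apply: Wl.
have [V VD WV] := dropW l.
have lastV : last_in V l by apply/last_inP => y neq; apply: WV; apply: Wl.
have [El|El] := doubling_last VD lastV; rewrite El in lastW; last exact: clf.
rewrite -doubling_swap; apply: clf; last first.
  by have := last_in_relabel t lastW; rewrite tpermL.
move=> x; have [U UD WU] := dropW (t x).
exists (relabel t U); rewrite ?doubling_swap // => y.
by rewrite !prefers_relabel_tperm; apply: WU.
Qed.

Lemma doubling_full D : full D -> full (doubling D).
Proof.
move=> fuD.
have fu u x y : u \in D -> prefers (extend u) y x -> exists z V,
    [/\ V \in doubling D, prefers (extend u) z x
      & forall w, w != z -> ~~ prefers (extend u) x w -> prefers V w z].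
  move=> uD yx; have [->|/embedP[b Ex]] := eqVneq x f.
    exists s, (relabel t (extend u)); split.
    - by rewrite doubling_swap mem_doubling.
    - exact: (last_inP _ _ (extend_last u) _ (i_neq s0)).
    - move=> w neq_ws _; rewrite prefers_relabel_tperm tpermL.
      apply: (last_inP _ _ (extend_last u)).
      by rewrite -[X in _ != X](tpermL s f) (inj_eq perm_inj).
  rewrite Ex in yx *; have /embedP[c Ey] : y != f.
    by apply: contraTneq yx => ->; rewrite prefers_extend_last.
  rewrite Ey prefers_extend in yx; have [z [v [vD zb zlast]]] := fuD u b c uD yx.
  exists (i z), (extend v); rewrite mem_doubling prefers_extend; split=> // w neq_wz.
  have [->|/embedP[d Ew]] := eqVneq w f.
    by rewrite (last_inP _ _ (extend_last u)).
  by rewrite Ew !prefers_extend; apply: zlast; apply: contraNneq neq_wz => <-; rewrite Ew.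
move=> W x y /doublingP[u uD [->|->]]; first exact: fu.
rewrite prefers_relabel_tperm => /(fu u _ _ uD)[z [V [VD zx zlast]]].
exists (t z), (relabel t V); rewrite doubling_swap prefers_relabel_tperm tpermK.
split=> // w neq; rewrite !prefers_relabel_tperm tpermK; apply: zlast.
by apply: contraNneq neq => <-; rewrite tpermK.
Qed.

Lemma doubling_mirrored D u :
  u \in D -> first_in u s0 -> mirrored (doubling D) s f (extend u).
Proof.
move=> uD us0; split; rewrite ?doubling_swap ?mem_doubling ?extend_last //.
exact: extend_first.
Qed.

Lemma doubling_maximal D :
  terminal D s0 -> maximal_arrow_single_peaked D ->
  maximal_arrow_single_peaked (doubling D).
Proof.
move=> ts maxD; have spD := maximal_single_peaked maxD.
apply: drop_closed_full_maximal.
- by have [u uD] := maximal_inhabited maxD; exists (extend u); rewrite mem_doubling.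
- exact: doubling_single_peaked.
- by apply: doubling_drop_closed => //; apply: maximal_drop_closed.
- by apply: doubling_full; apply: maximal_full.
Qed.

Definition halving E : {set linorder B} := extend @^-1: E.

Section Halve.

Variables (E : {set linorder A}) (w : linorder B).
Hypotheses (maxE : maximal_arrow_single_peaked E) (w_first : first_in w s0).
Hypothesis mirE : mirrored E s f (extend w).

Let spE := maximal_single_peaked maxE.
Let clE := maximal_drop_closed maxE.
Let fuE := maximal_full maxE.

(** Every order of [E] ends with [f] or [s], and the transposition exchanges the
    two halves. *)
Lemma halvingK : doubling (halving E) = E.
Proof.
have st W : (relabel t W \in E) = (W \in E).
  apply/idP/idP => [|]; last exact: (mirrored_stable spE clE mirE).
  by move=> /(mirrored_stable spE clE mirE); rewrite relabel_tpermK.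
apply/setP=> W; apply/doublingP/idP => [[u]|WE].
  by rewrite inE => uE [->|->]; rewrite ?st.
have [l _ Wl] := @last_among _ W predT f isT.
have lastW : last_in W l by apply/last_inP => y; apply: Wl.
have tl : terminal E l by apply/exists_inP; exists W.
have [El|El] := mirrored_terminal spE (i_neq s0) mirE tl; rewrite El in lastW.
  have := last_in_relabel t lastW; rewrite tpermL.
  case/last_in_extend=> u Eu; exists u; first by rewrite inE -Eu st.
  by right; rewrite -Eu relabel_tpermK.
have [u Eu] := last_in_extend lastW; exists u; first by rewrite inE -Eu.
by left.
Qed.

(** An order of [E] that ends with [s] can still be used above [b], when the
    part below [b] is taken from an order that ends with [f]. *)
Lemma halving_splice V u b :
  V \in E -> u \in halving E -> exists2 v, v \in halving E &
    forall c d, ~~ prefers u b d ->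
      prefers v c d = ~~ prefers u b c && prefers V (i c) (i d).
Proof.
rewrite inE => VE uE; have [W WE EW] := drop_closed_splice (i b) clE VE uE.
have /last_in_extend[v Ev] : last_in W f.
  by apply/last_inP => y neq; rewrite EW !(last_inP _ _ (extend_last u)).
exists v => [|c d bd]; first by rewrite inE -Ev.
by rewrite -!prefers_extend -Ev EW prefers_extend (negbTE bd).
Qed.

Lemma mem_halving : w \in halving E.
Proof. by have [_ _ PE _] := mirE; rewrite inE. Qed.

Lemma halving_maximal : maximal_arrow_single_peaked (halving E).
Proof.
apply: drop_closed_full_maximal; first by exists w; apply: mem_halving.
- have ext a b c : bottom (halving E) a b c -> bottom E (i a) (i b) (i c).
    by case=> u; rewrite inE => uE H; exists (extend u); rewrite ?prefers_extend.
  by move=> a b c; do 3!move=> /ext ?; apply: (spE (a := i a) (b := i b) (c := i c)).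
- move=> u dropu; rewrite inE; apply: clE => x.
  have [_ Pf PE _] := mirE; have [->|/embedP[b Ex]] := eqVneq x f.
    by exists (extend w) => // y /prefers_neq; apply/last_inP.
  have [v] := dropu b; rewrite inE Ex => vE uv; exists (extend v) => // y yb.
  have /embedP[c Ey] : y != f.
    by apply: contraTneq yb => ->; rewrite prefers_extend_last.
  by move: yb; rewrite Ey !prefers_extend; apply: uv.
- move=> u b c uD cb; have uE : extend u \in E by rewrite inE in uD.
  have [z [V [VE zb zlast]]] : exists z V, [/\ V \in E, prefers (extend u) z (i b)
      & forall x, x != z -> ~~ prefers (extend u) (i b) x -> prefers V x z].
    by apply: (fuE (y := i c)); rewrite ?prefers_extend.
  have /embedP[d Ez] : z != f.
    by apply: contraTneq zb => ->; rewrite prefers_extend_last.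
  rewrite Ez prefers_extend in zb zlast.
  have [v vD Ev] := halving_splice b VE uD; exists d, v; split=> // a neq_ad nba.
  rewrite Ev; last by apply/negP => /(prefers_asym zb).
  by rewrite nba zlast ?(inj_eq i_inj) // prefers_extend.
Qed.

(** The mirror image of [extend w] has [s] last; moving [f] from its top to the
    bottom gives an order of [E]. *)
Lemma halving_terminal : terminal (halving E) s0.
Proof.
have [_ /last_inP Qs QE _] := mirrored_sym mirE.
have [l _ wl] := @last_among _ w predT s0 isT.
have nl c : ~~ prefers w l c.
  apply/negP => lc; apply: (prefers_asym lc); apply: wl => //.
  by rewrite eq_sym (prefers_neq lc).
have [v vD Ev] := halving_splice l QE mem_halving.
apply/exists_inP; exists v => //; apply/last_inP => c neq.
by rewrite Ev // nl Qs // (inj_eq i_inj).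
Qed.

End Halve.

End Doubling.

(** * Isomorphism and counting *)

Section Isomorphism.

Variable A : finType.

Implicit Types (D E : {set linorder A}) (W : linorder A) (g h : {perm A}).

Lemma relabel_domainM g h D :
  relabel_domain (g * h)%g D = relabel_domain h (relabel_domain g D).
Proof. by rewrite /relabel_domain -imset_comp; apply: eq_imset => W; apply: relabelM. Qed.

Lemma relabel_domain1 D : relabel_domain 1%g D = D.
Proof.
rewrite /relabel_domain -[RHS]imset_id; apply: eq_imset => W; exact: relabel1.
Qed.

Lemma isomorphic_refl D : isomorphic D D.
Proof. by apply/existsP; exists 1%g; rewrite relabel_domain1. Qed.

Lemma isomorphic_trans : transitive (@isomorphic A).
Proof.
move=> D1 D2 D3 /existsP[g /eqP<-] /existsP[h /eqP<-].
by apply/existsP; exists (g * h)%g; rewrite relabel_domainM.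
Qed.

Lemma isomorphic_sym : symmetric (@isomorphic A).
Proof.
have sym D E : isomorphic D E -> isomorphic E D.
  case/existsP=> g /eqP<-; apply/existsP; exists g^-1%g.
  by rewrite -relabel_domainM mulgV relabel_domain1.
by move=> D E; apply/idP/idP; apply: sym.
Qed.

Lemma extremal_relabel g D W :
  extremal D W -> extremal (relabel_domain g D) (relabel g W).
Proof.
have ter x : terminal D x -> terminal (relabel_domain g D) (g x).
  case/exists_inP=> V VD Vx; apply/exists_inP.
  by exists (relabel g V); rewrite ?imset_f ?last_in_relabel.
case/andP=> WD /existsP[s /existsP[f /and5P[ts tf neq_sf Ws Wf]]].
rewrite /extremal imset_f //=; apply/existsP; exists (g s); apply/existsP.
exists (g f); rewrite !ter // (inj_eq perm_inj) neq_sf.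
by rewrite first_in_relabel ?last_in_relabel.
Qed.

(** An isomorphism between two domains with the same pair of extremal paths
    fixes or swaps these paths, hence is the identity or the transposition that
    preserves both domains. *)
Lemma mirrored_isomorphic D E s f P :
  single_peaked D -> drop_closed D -> single_peaked E -> s != f ->
  mirrored D s f P -> mirrored E s f P -> isomorphic D E -> D = E.
Proof.
move=> spD clD spE neq_sf mirD mirE /existsP[g /eqP EDE].
have := mirrored_extremal spE neq_sf mirE.
have := mirrored_extremal spD neq_sf mirD.
move=> /setP/(_ P); rewrite !inE eqxx => /(@extremal_relabel g); rewrite EDE.
move=> exP /setP/(_ (relabel g P)); rewrite !inE exP => /esym/orP[/eqP|/eqP Eg].
  by move/relabel_fix => g1; rewrite -EDE g1 relabel_domain1.
have Egt : (g * tperm s f)%g = 1%g.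
  by apply: (@relabel_fix _ _ P); rewrite relabelM Eg relabel_tpermK.
have {Egt} Eg1 : g = tperm s f by rewrite -[LHS]mulg1 -(tperm2 s f) mulgA Egt mul1g.
apply/eqP; rewrite -EDE Eg1 eq_sym eqEcard card_imset; last first.
  exact: can_inj (relabelK _).
rewrite leqnn andbT; apply/subsetP => _ /imsetP[W WD ->].
exact: (mirrored_stable spD clD mirD).
Qed.

End Isomorphism.

Section Counting.

Variables (A B : finType) (w : linorder B).
Hypothesis cardA : #|A| = #|B|.+1.

Implicit Types (D : {set linorder B}) (P : linorder A).

(** The embedding is chosen after the extremal path, so that a domain is a
    doubling on the nose and only the comparison of doublings involves an
    isomorphism. *)
Lemma extend_onto P : exists (i : B -> A) (f : A) (i_inj : injective i)
  (i_neq : forall b, i b != f), extend i_inj i_neq cardA w = P.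
Proof.
have /card_gt0P[x _] : 0 < #|A| by rewrite cardA.
have [f _ lastf] := @last_among _ P predT x isT.
have {}lastf y : y != f -> prefers P y f by apply: lastf.
have szP : size P = #|B|.+1 by rewrite size_tuple cardA.
pose i b := nth f P (index b w).
have ltw b : index b w < #|B|.
  have lt : index b w < size w by rewrite index_mem mem_linorder.
  by rewrite size_tuple in lt.
have ltP b : index b w < size P by rewrite szP ltnW // ltnS.
have iE b : index (i b) P = index b w by rewrite index_uniq ?linorder_uniq.
have i_inj : injective i.
  move=> b c Ebc; apply: (index_inj b (mem_linorder w b) (mem_linorder w c)).
  by rewrite /= -!iE Ebc.
have i_neq b : i b != f.
  apply/eqP => Eb; pose y := nth f P #|B|.
  have yE : index y P = #|B| by rewrite index_uniq ?linorder_uniq // szP.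
  have neq_yf : y != f by apply: contraTneq (ltw b) => Ey; rewrite -iE Eb -Ey yE ltnn.
  by have := lastf y neq_yf; rewrite /prefers yE -Eb iE ltnNge ltnW.
exists i, f, i_inj, i_neq; apply: linorder_inj => y z yz.
have [Ey|/(embedP i_inj i_neq cardA)[b Ey]] := eqVneq y f.
  by rewrite Ey prefers_extend_last in yz.
have [->|/(embedP i_inj i_neq cardA)[c Ez]] := eqVneq z f.
  by apply: lastf; rewrite Ey.
by move: yz; rewrite Ey Ez prefers_extend /prefers !iE.
Qed.

Lemma relabel_doubling (g : {perm A}) (i j : B -> A) (f h : A)
  (i_inj : injective i) (i_neq : forall b, i b != f)
  (j_inj : injective j) (j_neq : forall b, j b != h) s0 D :
  relabel g (extend i_inj i_neq cardA w) = extend j_inj j_neq cardA w ->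
  relabel_domain g (doubling i_inj i_neq cardA s0 D) =
  doubling j_inj j_neq cardA s0 D.
Proof.
move=> Ew.
have /rcons_inj[/eq_in_map Ei Ef] :
    rcons (map (g \o i) w) (g f) = rcons (map j w) h.
  by have := congr1 (fun P => path_of P : seq A) Ew; rewrite /= map_rcons -map_comp.
have {}Ei b : g (i b) = j b by apply: Ei; apply: mem_linorder.
have Eu u : relabel g (extend i_inj i_neq cardA u) = extend j_inj j_neq cardA u.
  do 2!apply: val_inj; rewrite /= map_rcons Ef -map_comp; congr rcons.
  exact: eq_map.
rewrite /relabel_domain /doubling imsetU -!imset_comp; congr (_ :|: _).
  exact: eq_imset.
apply: eq_imset => u /=; rewrite -Eu -!relabelM; congr relabel.
by rewrite conjgC tpermJ Ei Ef.
Qed.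

Lemma extremal_terminal D s0 : 1 < #|B| -> first_in w s0 ->
  extremal D w = (w \in D) && terminal D s0.
Proof.
move=> B2 ws0; rewrite /extremal; case: (boolP (w \in D)) => //= wD.
apply/existsP/idP => [[a /existsP[b /and5P[ta _ _ wa _]]]|ts].
  by rewrite (first_in_inj ws0 wa).
have [l _ wl] := @last_among _ w predT s0 isT.
have lastl : last_in w l by apply/last_inP => c; apply: wl.
exists s0; apply/existsP; exists l; rewrite ts ws0 lastl !andbT /=.
apply/andP; split; first by apply/exists_inP; exists w.
by apply: contraTneq B2 => El; rewrite -leqNgt (first_last_card ws0) // El.
Qed.

(** Doubling along a fixed embedding maps the domains counted on the right
    injectively to pairwise non-isomorphic domains and meets every class. *)
Lemma num_sigma_trivialE :
  1 < #|B| -> num_sigma_trivial A = num_sharing_extremal w.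
Proof.
move=> B2; have A2 : 1 < #|A| by rewrite cardA ltnW.
have /card_gt0P[b _] : 0 < #|B| by apply: ltnW.
have [s0 ws0] := first_in_exists w b.
have [P0 _] := linorder_inhabited A.
have [i [f [i_inj [i_neq _]]]] := extend_onto P0.
pose dbl := doubling i_inj i_neq cardA s0.
set Y := [set D | maximal_arrow_single_peaked D & extremal D w].
rewrite /num_sigma_trivial /equivalence_partition /num_sharing_extremal -/Y.
set X := [set E | maximal_arrow_single_peaked E & sigma_trivial E].
pose cls E := [set E' in X | isomorphic E E'].
have spM := maximal_single_peaked.
have dblM D : D \in Y -> maximal_arrow_single_peaked (dbl D) /\
    mirrored (dbl D) (i s0) f (extend i_inj i_neq cardA w).
  rewrite inE (extremal_terminal _ B2 ws0) => /and3P[maxD wD ts].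
  by split; [apply: doubling_maximal | apply: doubling_mirrored].
have dblX D : D \in Y -> dbl D \in X.
  case/dblM=> maxE mirE; rewrite inE maxE /=.
  apply/(sigma_trivialP (spM _ _ maxE) A2); exists (i s0), f.
  by exists (extend i_inj i_neq cardA w).
have clsE E E' : isomorphic E E' -> cls E = cls E'.
  move=> isoE; apply/setP=> E''; rewrite !inE; congr (_ && _).
  apply/idP/idP; last exact: isomorphic_trans.
  by apply: isomorphic_trans; rewrite isomorphic_sym.
transitivity #|[set cls (dbl D) | D in Y]|.
  apply: eq_card => K; apply/imsetP/imsetP => [[E EX ->]|[D DY ->]]; last first.
    by exists (dbl D); rewrite ?dblX.
  have := EX; rewrite inE => /andP[maxE /(sigma_trivialP (spM _ _ maxE) A2)].
  case=> s [h [P [neq_sh mirE]]].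
  have [j [h' [j_inj [j_neq EP]]]] := extend_onto P.
  have [Ps Ph _ _] := mirE; rewrite -EP in Ps Ph mirE.
  have Es : s = j s0.
    by apply: first_in_inj Ps _; apply: extend_first.
  have Eh : h = h'.
    apply/eqP; move: Ph; rewrite /last_in => /eqP <-.
    by rewrite /= last_rcons.
  rewrite {}Es {}Eh in Ps Ph neq_sh mirE.
  pose D := halving j_inj j_neq cardA E.
  have DY : D \in Y.
    rewrite inE (extremal_terminal _ B2 ws0) (halving_maximal maxE mirE).
    by rewrite (mem_halving mirE) (halving_terminal maxE mirE).
  exists D => //; apply: clsE; apply/existsP.
  have [g Eg] := relabel_transitive (extend j_inj j_neq cardA w)
    (extend i_inj i_neq cardA w).
  by exists g; rewrite -{1}(halvingK maxE mirE) (relabel_doubling _ _ Eg).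
rewrite card_in_imset // => D1 D2 D1Y D2Y Ecls.
have [max1 mir1] := dblM _ D1Y; have [max2 mir2] := dblM _ D2Y.
apply: (@doubling_inj _ _ _ _ i_inj i_neq cardA s0).
apply: (mirrored_isomorphic (spM _ _ max1) (maximal_drop_closed max1)
  (spM _ _ max2) (i_neq s0) mir1 mir2).
have : dbl D2 \in cls (dbl D1) by rewrite Ecls inE dblX ?isomorphic_refl.
by rewrite inE => /andP[].
Qed.

End Counting.

(** On two elements every set of orders is single-peaked, so the set of both
    orders is the only maximal domain. *)
Lemma num_sharing_extremal_two (B : finType) (w : linorder B) :
  #|B| = 2 -> num_sharing_extremal w = 1.
Proof.
move=> B2; have sp (D : {set linorder B}) : single_peaked D.
  move=> a b c Ba Bb _; have [ab bc ca] := bottom_neq Ba Bb.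
  suff: 2 < #|B| by rewrite B2.
  by apply/card_gt2P; exists a, b, c.
rewrite /num_sharing_extremal -(cards1 [set: linorder B]); apply: eq_card => D.
rewrite !inE; apply/andP/eqP => [[maxD _]|->].
  by apply/setP=> v; rewrite inE; apply: maximal_absorbs.
have /card_gt0P[b _] : 0 < #|B| by rewrite B2.
have [s ws] := first_in_exists w b.
split.
  apply/andP; split; first exact/arrow_single_peakedP.
  apply/maxsetP; split=> [|E _]; first exact: single_peaked_condorcet.
  by move=> sTE; apply/eqP; rewrite -subTset.
rewrite (extremal_terminal _ _ ws) ?B2 // inE /=.
have [l _ wl] := @last_among _ w predT s isT.
have lastl : last_in w l by apply/last_inP => c; apply: wl.
apply/exists_inP; exists (relabel (tperm l s) w); rewrite ?inE //.
by have := last_in_relabel (tperm l s) lastl; rewrite tpermL.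
Qed.

Theorem theorem6p2 (m : nat) (A : finType) (cardA : #|A| = m) :
  [/\ m = 3 -> num_sigma_trivial A = 1,
      4 <= m ->
        forall (B : finType) (w : linorder B), #|B| = m - 1 ->
          num_sigma_trivial A = num_sharing_extremal w
    & 3 <= m ->
        forall D : {set linorder A},
          maximal_arrow_single_peaked D -> sigma_trivial D -> self_paired D].
Proof.
split=> [m3|m4 B w cardB|m3 D maxD].
- have [w _] := linorder_inhabited 'I_2.
  rewrite (@num_sigma_trivialE _ _ w) ?card_ord ?cardA //.
  by apply: num_sharing_extremal_two; rewrite card_ord.
- have Em : m.-1.+1 = m := ltn_predK m4.
  apply: num_sigma_trivialE; rewrite cardB subn1 ?cardA ?Em //.
  by rewrite -ltnS Em ltnW.
have spD := maximal_single_peaked maxD.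
case/(sigma_trivialP spD); first by rewrite cardA ltnW.
move=> s [f [P [neq_sf mir]]].
exact: (mirrored_self_paired spD (maximal_drop_closed maxD) neq_sf mir).
Qed.
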